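(* Let $\mathrm{pen}$ be a real-valued polyhedral gauge on $\mathbb{R}^p$, $X\in\mathbb{R}^{n\times p}$ and $\lambda>0$. Then the optimization problem $\min_{b\in\mathbb{R}^p} \frac12\|y-Xb\|_2^2+\lambda\,\mathrm{pen}(b)$ is uniquely solvable for all $y\in\mathbb{R}^n$ if and only if no pattern with complexity exceeding $\mathrm{rk}(X)$ is accessible (with respect to $X$ and $\mathrm{pen}$).
   Context: A prime denotes transpose. A real-valued polyhedral gauge on $\mathbb{R}^p$ is a function of the form $\mathrm{pen}(b) = \max\{u_1'b,\dots,u_k'b\}$ for some $u_1,\dots,u_k \in \mathbb{R}^p$ with $u_1 = 0$; $\partial_{\mathrm{pen}}(\beta)$ is its subdifferential at $\beta$. For $y\in\mathbb{R}^n$ and $\lambda>0$ let $S_{X,\lambda\mathrm{pen}}(y)$ be the set of minimizers of $b\mapsto\frac12\|y-Xb\|_2^2 + \lambda\,\mathrm{pen}(b)$ over $\mathbb{R}^p$. The pattern class of $\beta\in\mathbb{R}^p$ is $C_\beta = \{b\in\mathbb{R}^p : \partial_{\mathrm{pen}}(b) = \partial_{\mathrm{pen}}(\beta)\}$ and the complexity of the pattern of $\beta$ is the dimension of the linear span of $C_\beta$. The pattern of $\beta$ is accessible with respect to $X$ and $\lambda\,\mathrm{pen}$ if there exist $y\in\mathbb{R}^n$ and $\hat\beta \in S_{X,\lambda\mathrm{pen}}(y)$ with $\hat\beta\in C_\beta$; this does not depend on the value of $\lambda>0$, so one says ''accessible with respect to $X$ and $\mathrm{pen}$''. $\mathrm{rk}(X)$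 is the rank of $X$. *)

(* Defs.v *)
From HB Require Import structures.
From mathcomp Require Import all_boot all_order all_algebra.
From mathcomp Require Import boolp classical_sets reals.
From mathcomp Require Import ring lra.

Set Implicit Arguments.
Unset Strict Implicit.
Unset Printing Implicit Defensive.

Import Order.TTheory GRing.Theory Num.Theory.

Local Open Scope classical_set_scope.
Local Open Scope ring_scope.

Definition dotv (R : realType) (m : nat) (u v : 'cV[R]_m) : R :=
  (u^T *m v) 0 0.

(* The norm that MathComp-Analysis puts on matrices is the sup norm. *)
Definition norm2 (R : realType) (m : nat) (v : 'cV[R]_m) : R :=
  Num.sqrt (\sum_(i < m) v i 0 ^+ 2).

(* Starting the iterated maximum from one of its own terms makes it the maximum
   of the family, with no artificial default value. *)
Definition polyhedral_gauge (R : realType) (p : nat) (pen : 'cV[R]_p -> R) :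
    Prop :=
  exists (k : nat) (u : 'I_k.+1 -> 'cV[R]_p),
    u ord0 = 0 /\
    forall b, pen b = \big[Num.max/dotv (u ord0) b]_(i < k.+1) dotv (u i) b.

Definition subdifferential (R : realType) (p : nat) (f : 'cV[R]_p -> R)
    (beta : 'cV[R]_p) : set 'cV[R]_p :=
  [set s | forall b, f beta + dotv s (b - beta) <= f b].

Definition objective (R : realType) (n p : nat) (X : 'M[R]_(n, p)) (lam : R)
    (pen : 'cV[R]_p -> R) (y : 'cV[R]_n) (b : 'cV[R]_p) : R :=
  2^-1 * norm2 (y - X *m b) ^+ 2 + lam * pen b.

Definition minimizers (R : realType) (n p : nat) (X : 'M[R]_(n, p)) (lam : R)
    (pen : 'cV[R]_p -> R) (y : 'cV[R]_n) : set 'cV[R]_p :=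
  [set b | forall b',
     objective X lam pen y b <= objective X lam pen y b'].

Definition pattern_class (R : realType) (p : nat) (pen : 'cV[R]_p -> R)
    (beta : 'cV[R]_p) : set 'cV[R]_p :=
  [set b | subdifferential pen b = subdifferential pen beta].

Definition is_linear_span (R : realType) (p : nat) (A : set 'cV[R]_p)
    (U : {vspace 'cV[R]_p}) : Prop :=
  (forall b, A b -> b \in U) /\
  (forall W : {vspace 'cV[R]_p}, (forall b, A b -> b \in W) -> (U <= W)%VS).

(* [<<_>>%VS] only spans finite sequences. The default value is never used, by
   [linear_spanP]. *)
Definition linear_span (R : realType) (p : nat) (A : set 'cV[R]_p) :
    {vspace 'cV[R]_p} :=
  xget 0%VS (is_linear_span A).

Lemma linear_spanP (R : realType) (p : nat) (A : set 'cV[R]_p) :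
  is_linear_span A (linear_span A).
Proof.
suff [U HU] : exists U, is_linear_span A U.
  by rewrite /linear_span; apply: (xgetPex 0%VS); exists U.
pose P d := `[< exists2 W : {vspace 'cV[R]_p},
                 forall b, A b -> b \in W & \dim W = d >].
have exP : exists d, P d.
  exists (\dim (fullv : {vspace 'cV[R]_p})); apply/asboolP.
  by exists fullv => // b _; rewrite memvf.
case: (ex_minnP exP) => d /asboolP [U AU dU] dmin.
exists U; split=> // W AW.
have /eqP <- : (U :&: W)%VS == U.
  rewrite eqEdim capvSl /= dU; apply: dmin; apply/asboolP.
  by exists (U :&: W)%VS => // b Ab; rewrite memv_cap AU ?AW.
exact: capvSr.
Qed.

Definition complexity (R : realType) (p : nat) (pen : 'cV[R]_p -> R)
    (beta : 'cV[R]_p) : nat :=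
  \dim (linear_span (pattern_class pen beta)).

Definition accessible (R : realType) (n p : nat) (X : 'M[R]_(n, p)) (lam : R)
    (pen : 'cV[R]_p -> R) (beta : 'cV[R]_p) : Prop :=
  exists (y : 'cV[R]_n) (bhat : 'cV[R]_p),
    minimizers X lam pen y bhat /\ pattern_class pen beta bhat.

Lemma dotvE (R : realType) (m : nat) (u v : 'cV[R]_m) :
  dotv u v = \sum_(i < m) u i 0 * v i 0.
Proof. by rewrite /dotv mxE; apply: eq_bigr => i _; rewrite mxE. Qed.

Lemma sqr_norm2 (R : realType) (m : nat) (v : 'cV[R]_m) :
  norm2 v ^+ 2 = dotv v v.
Proof.
rewrite /norm2 sqr_sqrtr ?sumr_ge0 // => [|i _]; last exact: sqr_ge0.
by rewrite dotvE; apply: eq_bigr => i _; rewrite expr2.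
Qed.

Lemma sqr_norm2BZ (R : realType) (m : nat) (u v : 'cV[R]_m) (t : R) :
  norm2 (u - t *: v) ^+ 2 =
    norm2 u ^+ 2 - 2 * t * dotv u v + t ^+ 2 * norm2 v ^+ 2.
Proof.
rewrite !sqr_norm2 !dotvE !mulr_sumr -sumrB -big_split /=.
by apply: eq_bigr => i _; rewrite !mxE; ring.
Qed.

Lemma dotvDr (R : realType) (m : nat) (u v w : 'cV[R]_m) :
  dotv u (v + w) = dotv u v + dotv u w.
Proof. by rewrite /dotv mulmxDr mxE. Qed.

Lemma dotvZr (R : realType) (m : nat) (t : R) (u v : 'cV[R]_m) :
  dotv u (t *: v) = t * dotv u v.
Proof. by rewrite /dotv -scalemxAr mxE. Qed.

Lemma dotvZl (R : realType) (m : nat) (t : R) (u v : 'cV[R]_m) :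
  dotv (t *: u) v = t * dotv u v.
Proof. by rewrite /dotv linearZ -scalemxAl mxE. Qed.

Lemma gauge_convex (R : realType) (p : nat) (pen : 'cV[R]_p -> R)
    (a d : 'cV[R]_p) (t : R) :
  polyhedral_gauge pen -> 0 <= t <= 1 ->
  pen (a + t *: d) <= pen a + t * (pen (a + d) - pen a).
Proof.
move=> [k [u [_ penE]]] /andP[t0 t1].
have le_pen i b : dotv (u i) b <= pen b
  by rewrite penE (le_bigmax _ (fun i => dotv (u i) b)).
have key i : dotv (u i) (a + t *: d) <= pen a + t * (pen (a + d) - pen a).
  have := le_pen i a; have := le_pen i (a + d).
  rewrite !dotvDr dotvZr; move: (dotv _ _) (dotv _ _) (pen _) (pen _) => *.
  nra.
by rewrite penE; apply/bigmax_leP; split=> // i _; exact: key.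
Qed.

Lemma minimizersP (R : realType) (n p : nat) (X : 'M[R]_(n, p)) (lam : R)
    (pen : 'cV[R]_p -> R) (y : 'cV[R]_n) (b : 'cV[R]_p) :
  polyhedral_gauge pen -> 0 < lam ->
  minimizers X lam pen y b <->
  forall d, dotv (y - X *m b) (X *m d) <= lam * (pen (b + d) - pen b).
Proof.
move=> gpen lam0; rewrite /minimizers /objective /=.
have expand t d : norm2 (y - X *m (b + t *: d)) ^+ 2 =
    norm2 (y - X *m b) ^+ 2 - 2 * t * dotv (y - X *m b) (X *m d)
    + t ^+ 2 * norm2 (X *m d) ^+ 2.
  by rewrite mulmxDr -scalemxAr opprD addrA sqr_norm2BZ.
split=> [bmin d|H b'].
- set A := dotv _ _; set B := lam * _; rewrite leNgt; apply/negP => BA.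
  set q := norm2 (X *m d) ^+ 2; have q0 : 0 <= q by exact: sqr_ge0.
  pose t := Num.min 1 ((A - B) / (q + 1)).
  have t0 : 0 < t.
    by rewrite lt_min ltr01 /= divr_gt0 ?subr_gt0 // ltr_wpDl.
  have t1 : t <= 1 by rewrite ge_min lexx.
  have tq : t * (q + 1) <= A - B.
    by rewrite -ler_pdivlMr ?ltr_wpDl // ge_min lexx orbT.
  have := bmin (b + t *: d); rewrite expand -/A -/q.
  have t01 : 0 <= t <= 1 by rewrite t1 ltW.
  have := ler_wpM2l (ltW lam0) (gauge_convex b d gpen t01).
  rewrite mulrDr mulrCA -/B => h1 h2.
  have h3 : t * A <= t * B + t * (2^-1 * (t * q)) by lra.
  have h4 : A <= B + 2^-1 * (t * q) by rewrite -(ler_pM2l t0) mulrDr.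
  have tq0 : 0 <= t * q by rewrite mulr_ge0 // ltW.
  lra.
- have bb' : b + (b' - b) = b' by rewrite addrC subrK.
  have := H (b' - b); have := expand 1 (b' - b).
  rewrite scale1r bb' => ->.
  have := sqr_ge0 (norm2 (X *m (b' - b))).
  lra.
Qed.

(* Hence one may speak of accessibility with respect to [X] and [pen]. *)
Lemma accessible_indep (R : realType) (n p : nat) (X : 'M[R]_(n, p))
    (lam mu : R) (pen : 'cV[R]_p -> R) (beta : 'cV[R]_p) :
  polyhedral_gauge pen -> 0 < lam -> 0 < mu ->
  accessible X lam pen beta -> accessible X mu pen beta.
Proof.
move=> gpen lam0 mu0 [y [b [/(minimizersP _ _ _ gpen lam0) bmin Cb]]].
exists (X *m b + (mu / lam) *: (y - X *m b)), b; split=> //.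
apply/(minimizersP _ _ _ gpen mu0) => d.
rewrite [X *m b + _]addrC addrK dotvZl.
have -> : mu = mu / lam * lam by rewrite divfK ?gt_eqF.
rewrite mulfK ?gt_eqF // -(mulrA _ lam); apply: ler_wpM2l (bmin d).
by rewrite ltW // divr_gt0.
Qed.

(* Main.v *)
Require Import Defs.
From mathcomp Require Import all_boot all_order all_algebra.
From mathcomp Require Import boolp classical_sets reals.
From mathcomp Require Import ring lra.

(** Write the gauge as [pen b = max_i dotv (u i) b], let [I b] be the set of
    indices attaining the maximum at [b], and call a direction [d] flat at [b]
    when the [u i], [i] in [I b], agree on [d]. Two points have the same
    subdifferential exactly when they have the same active set, and a small
    step creates no new active index; hence the span of the pattern class of
    [b] is the space [V_b] of its flat directions ([complexity_maxdot]). Also,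
    [b] is a minimizer for some [y] iff the subdifferential at [b] meets the
    row space of [X] ([minimizers_subdifferential]).

    Uniqueness forbids complex accessible patterns: if [b] is a minimizer and
    the dimension of [V_b] exceeds the rank of [X], some nonzero [d] in [V_b]
    is killed by [X]. The objective is affine along [d] near [b], so constant
    by minimality, and there are other minimizers.

    For the converse, minimizers exist for every [y], even though the objective
    need not be coercive ([minimizer_exists]): on each of the finitely many
    strata with given active set the objective is a convex quadratic, all its
    critical points on a stratum have the same value, and every point descends
    to a critical point of some stratum. If two minimizers differ, their
    midpoint [m] has a nonzero flat direction [d] in the kernel of [X]. Going
    down to a smallest face of the subdifferential at [m] that still meets the
    row space of [X] yields a pattern that keeps [d] as a flat direction
    ([face_shrink], [accessible_complex]). If the flat space of that pattern
    had dimension at most the rank of [X], then, [d] being both flat and in the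
    kernel, some nonzero [w] in the row space would be orthogonal to the flat
    space, that is, parallel to the face; following [w] to the boundary of the
    face would reach a smaller face that meets the row space. So its complexity
    exceeds the rank of [X].

    Convex duality enters only in finding that boundary point together with an
    exposing direction of a proper face containing it. Both come from one
    further instance of [minimizer_exists], with the one-row design [w^T] and
    the gauge of the face. *)

Set Implicit Arguments.
Unset Strict Implicit.

Import Order.TTheory GRing.Theory Num.Theory.

Local Open Scope classical_set_scope.
Local Open Scope ring_scope.

(** * Dot products *)

Section DotProduct.

Variable R : realType.

Lemma dotvC m (u v : 'cV[R]_m) : dotv u v = dotv v u.
Proof. by rewrite !dotvE; apply: eq_bigr => i _; rewrite mulrC. Qed.

Lemma dotvDl m (u v w : 'cV[R]_m) : dotv (u + v) w = dotv u w + dotv v w.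
Proof. by rewrite dotvC dotvDr dotvC [dotv w v]dotvC. Qed.

Lemma dotvNl m (u v : 'cV[R]_m) : dotv (- u) v = - dotv u v.
Proof. by rewrite -scaleN1r dotvZl mulN1r. Qed.

Lemma dotvNr m (u v : 'cV[R]_m) : dotv u (- v) = - dotv u v.
Proof. by rewrite -scaleN1r dotvZr mulN1r. Qed.

Lemma dotvBl m (u v w : 'cV[R]_m) : dotv (u - v) w = dotv u w - dotv v w.
Proof. by rewrite dotvDl dotvNl. Qed.

Lemma dotvBr m (u v w : 'cV[R]_m) : dotv u (v - w) = dotv u v - dotv u w.
Proof. by rewrite dotvDr dotvNr. Qed.

Lemma dot0v m (v : 'cV[R]_m) : dotv 0 v = 0.
Proof. by rewrite -(scale0r 0) dotvZl mul0r. Qed.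

Lemma dotv0 m (v : 'cV[R]_m) : dotv v 0 = 0.
Proof. by rewrite dotvC dot0v. Qed.

Lemma dotv_mulmxr m n (X : 'M[R]_(m, n)) z d :
  dotv z (X *m d) = dotv (X^T *m z) d.
Proof. by rewrite /dotv trmx_mul trmxK mulmxA. Qed.

Lemma dotvv_ge0 m (v : 'cV[R]_m) : 0 <= dotv v v.
Proof. by rewrite -sqr_norm2 sqr_ge0. Qed.

Lemma dotvv_eq0 m (v : 'cV[R]_m) : (dotv v v == 0) = (v == 0).
Proof.
apply/eqP/eqP => [|->]; last by rewrite dot0v.
rewrite dotvE => /eqP; rewrite psumr_eq0 => [/allP v0|i _]; last first.
  by rewrite -expr2 sqr_ge0.
apply/colP => i; rewrite mxE; apply/eqP.
by have := v0 i (mem_index_enum i); rewrite mulf_eq0 orbb.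
Qed.

Lemma dotvv_gt0 m (v : 'cV[R]_m) : (0 < dotv v v) = (v != 0).
Proof. by rewrite lt_def dotvv_ge0 dotvv_eq0 andbT. Qed.

End DotProduct.

(** * Active indices, subdifferentials and patterns *)

Section Gauge.

Variables (R : realType) (p k : nat).
Implicit Types (u : 'I_k.+1 -> 'cV[R]_p) (b c d h s : 'cV[R]_p).

Definition maxdot u b : R :=
  \big[Num.max/dotv (u ord0) b]_(i < k.+1) dotv (u i) b.

Lemma polyhedral_gauge_maxdot u : u ord0 = 0 -> polyhedral_gauge (maxdot u).
Proof. by move=> u0; exists k, u. Qed.

Lemma dotv_le_maxdot u i b : dotv (u i) b <= maxdot u b.
Proof. exact: (le_bigmax _ (fun i => dotv (u i) b)). Qed.

Lemma maxdot_le u b (m : R) : (forall i, dotv (u i) b <= m) -> maxdot u b <= m.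
Proof. by move=> um; apply/bigmax_leP; split. Qed.

Lemma maxdot_ge0 u b : u ord0 = 0 -> 0 <= maxdot u b.
Proof. by move=> u0; have := dotv_le_maxdot u ord0 b; rewrite u0 dot0v. Qed.

Lemma maxdot0 u : maxdot u 0 = 0.
Proof.
apply/eqP; rewrite eq_le; apply/andP; split.
  by apply: maxdot_le => i; rewrite dotv0.
by have := dotv_le_maxdot u ord0 0; rewrite dotv0.
Qed.

Definition active u b : {set 'I_k.+1} := [set i | dotv (u i) b == maxdot u b].

Lemma activeP u b i : reflect (dotv (u i) b = maxdot u b) (i \in active u b).
Proof. by rewrite inE; apply: eqP. Qed.

Lemma active_le u b i j : i \in active u b -> dotv (u j) b <= dotv (u i) b.
Proof. by move/activeP->; apply: dotv_le_maxdot. Qed.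

Lemma le_active u b i : (forall j, dotv (u j) b <= dotv (u i) b) ->
  i \in active u b.
Proof.
move=> ui; apply/activeP/eqP.
by rewrite eq_le dotv_le_maxdot maxdot_le.
Qed.

Lemma active_ex u b : exists i, i \in active u b.
Proof.
case: (arg_maxP (fun i => dotv (u i) b) (erefl (xpredT (ord0 : 'I_k.+1)))).
move=> i _ ui.
by exists i; apply: le_active => j; apply: ui.
Qed.

(** The index [j] is active at [b], and each inactive [i] stays strictly below
    it for a step small compared with its gap at [b]; there are finitely many
    of them. *)
Lemma active_ray u b h :
  exists2 e : R, 0 < e & active u (b + e *: h) \subset active u b.
Proof.
have [j jb] := active_ex u b.
have gap i : exists2 e : R, 0 < e &
    i \notin active u b -> forall t : R, 0 < t <= e ->
    dotv (u i) (b + t *: h) < dotv (u j) (b + t *: h).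
  have [ib|ib] := boolP (i \in active u b); first by exists 1.
  have lt_ij : dotv (u i) b < dotv (u j) b.
    rewrite lt_neqAle active_le // andbT; apply: contra ib => /eqP ij.
    by apply/activeP; rewrite ij; apply/activeP.
  set m := `|dotv (u i) h - dotv (u j) h| + 1.
  have m0 : 0 < m by rewrite ltr_wpDl.
  exists ((dotv (u j) b - dotv (u i) b) / (2 * m)).
    by rewrite divr_gt0 ?subr_gt0 ?mulr_gt0.
  move=> _ t /andP[t0]; rewrite ler_pdivlMr ?mulr_gt0 // => tm.
  have := ler_norm (dotv (u i) h - dotv (u j) h).
  by rewrite !dotvDr !dotvZr /m in m0 tm *; nra.
have [e e0 eP] := fin_all_exists2 gap.
have e_gt0 : 0 < \big[Num.min/1]_i e i by apply: lt_bigmin.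
exists (\big[Num.min/1]_i e i) => //.
apply/fintype.subsetP => i; apply: contraTT => ib.
have : dotv (u i) (b + \big[Num.min/1]_i e i *: h)
     < dotv (u j) (b + \big[Num.min/1]_i e i *: h).
  by apply: eP => //; rewrite e_gt0 bigmin_le.
by apply: contraTN => /active_le; rewrite -leNgt.
Qed.

Lemma subdifferential_maxdotP u b s :
  subdifferential (maxdot u) b s <->
  (forall c, dotv s c <= maxdot u c) /\ maxdot u b <= dotv s b.
Proof.
split=> [sb|[s_le sb] c]; last first.
  by rewrite dotvBr; have := s_le c; lra.
have b_le : maxdot u b <= dotv s b.
  by have := sb 0; rewrite maxdot0 sub0r dotvNr; lra.
split=> // c.
(* The gauge is subadditive, so testing the subgradient at [b + c] suffices. *)
have : maxdot u (b + c) <= maxdot u b + maxdot u c.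
  by apply: maxdot_le => i; rewrite dotvDr lerD ?dotv_le_maxdot.
by have := sb (b + c); rewrite addrAC subrr add0r; lra.
Qed.

Lemma active_subdifferential u b i :
  i \in active u b <-> subdifferential (maxdot u) b (u i).
Proof.
split=> [/activeP ib|/subdifferential_maxdotP[_ ib]].
  apply/subdifferential_maxdotP; split; last by rewrite ib.
  by move=> c; apply: dotv_le_maxdot.
by apply/activeP/eqP; rewrite eq_le ib dotv_le_maxdot.
Qed.

(** Going slightly beyond [b] on the ray from [c] through [b] stays within the
    active indices of [b], so the gauge is affine on a segment with [b] in its
    interior and [c] as an endpoint; a subgradient at [b] must be tight on all
    of it. *)
Lemma subdifferentialS u b c : active u b \subset active u c ->
  (subdifferential (maxdot u) b `<=` subdifferential (maxdot u) c)%classic.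
Proof.
move=> bc s /subdifferential_maxdotP[s_le sb].
apply/subdifferential_maxdotP; split=> //.
have [e e0 /fintype.subsetP eb] := active_ray u b (b - c).
have [j jb'] := active_ex u (b + e *: (b - c)).
have /activeP jb := eb _ jb'.
have /activeP jc := fintype.subsetP bc _ (eb _ jb').
move/activeP: jb' => jb'; have := s_le (b + e *: (b - c)).
rewrite -jb' !dotvDr !dotvZr !dotvBr jb jc => h.
have : e * (maxdot u c - dotv s c) <= 0 by nra.
by rewrite pmulr_rle0 // subr_le0.
Qed.

Lemma pattern_class_maxdot u b :
  pattern_class (maxdot u) b = [set c | active u c = active u b].
Proof.
apply/seteqP; split=> c /= bc; last first.
  by apply/seteqP; split; apply: subdifferentialS; rewrite bc.
apply/setP => i; apply/idP/idP => /active_subdifferential.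
  by rewrite bc => /active_subdifferential.
by rewrite -bc => /active_subdifferential.
Qed.

(** The directions in which [b] can be moved without leaving its pattern. *)
Definition flat u b d :=
  forall i j, i \in active u b -> j \in active u b ->
  dotv (u i) d = dotv (u j) d.

Lemma flatN u b d : flat u b d -> flat u b (- d).
Proof. by move=> bd i j ib jb; rewrite !dotvNr (bd i j). Qed.

Lemma flatZ u b t d : flat u b d -> flat u b (t *: d).
Proof. by move=> bd i j ib jb; rewrite !dotvZr (bd i j). Qed.

Lemma flat_pattern u b c : active u c = active u b -> flat u b c.
Proof.
by move=> cb i j; rewrite -cb => /activeP-> /activeP->.
Qed.

Lemma flat_active_eq u b d : flat u b d ->
  active u (b + d) \subset active u b -> active u (b + d) = active u b.
Proof.
move=> bd sub; apply/eqP; rewrite finset.eqEsubset sub.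
apply/fintype.subsetP => i ib.
have [j jd] := active_ex u (b + d); have jb := fintype.subsetP sub _ jd.
apply/activeP; move/activeP: jd => <-; rewrite !dotvDr (bd i j) //.
by move/activeP: ib => ->; move/activeP: jb => ->.
Qed.

Lemma flat_ray u b d : flat u b d ->
  exists2 e : R, 0 < e & active u (b + e *: d) = active u b.
Proof.
move=> bd; have [e e0 eb] := active_ray u b d; exists e => //.
by apply: flat_active_eq => //; apply: flatZ.
Qed.

(** For [j] active at [b] the rows span the direction space of the face
    [conv {u i | i active}]; the zero rows keep the number of rows constant. *)
Definition edges u b (j : 'I_k.+1) : 'M[R]_(k.+1, p) :=
  \matrix_i (if i \in active u b then (u i - u j)^T else 0).

Lemma edges_flatP u b j d : j \in active u b ->
  edges u b j *m d = 0 <-> flat u b d.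
Proof.
move=> jb; split=> [Ed|bd].
  have key i : i \in active u b -> dotv (u i) d = dotv (u j) d.
    move=> ib; apply/eqP; rewrite -subr_eq0 -dotvBl.
    have /rowP/(_ 0) := congr1 (row i) Ed.
    by rewrite row_mul rowK ib !mxE /dotv mxE => ->.
  by move=> i i' ib i'b; rewrite key // [RHS]key.
apply/row_matrixP => i; rewrite row_mul rowK row0.
case: ifP => ib; last by rewrite mul0mx.
apply/rowP => z; rewrite ord1 [RHS]mxE.
have := dotvBl (u i) (u j) d.
by rewrite (bd i j) // subrr.
Qed.

Definition flat_mx u b j := kermx (edges u b j)^T.

Lemma flat_mxP u b j d : j \in active u b ->
  (d^T <= flat_mx u b j)%MS <-> flat u b d.
Proof.
move=> jb; rewrite -(edges_flatP _ jb); split=> [/sub_kermxP|] Ed.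
  by apply: trmx_inj; rewrite trmx_mul Ed trmx0.
by apply/sub_kermxP; rewrite -trmx_mul Ed trmx0.
Qed.

(** Translates between the two encodings of a subspace of column vectors. *)
Lemma dim_row_space (U : {vspace 'cV[R]_p}) m (M : 'M[R]_(m, p)) :
  (forall d, d \in U <-> (d^T <= M)%MS) -> \dim U = \rank M.
Proof.
move=> UM.
pose f := linfun (trmx \o mulmxr (row_base M) : 'rV[R]_(\rank M) -> 'cV[R]_p).
have fE (c : 'rV_(\rank M)) : f c = (c *m row_base M)^T by rewrite lfunE.
have -> : U = limg f.
  apply/vspaceP => d; apply/idP/memv_imgP => [/UM|[c _ ->]].
    rewrite -(eq_row_base M) => /submxP[c dc].
    by exists c; rewrite ?memvf // fE -dc trmxK.
  by apply/UM; rewrite fE trmxK -(eq_row_base M) submxMl.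
rewrite limg_dim_eq; first by rewrite dimvf dim_matrix mul1r.
apply/eqP; rewrite -subv0 capfv; apply/subvP => c.
rewrite memv_ker fE memv0 => /eqP fc; apply/eqP.
apply: (row_free_inj (row_base_free M)).
by apply: trmx_inj; rewrite mul0mx trmx0.
Qed.

(** A small multiple of a flat direction added to [b] stays in the pattern
    class, so this direction is a difference of two elements of the class. *)
Lemma complexity_maxdot u b j : j \in active u b ->
  complexity (maxdot u) b = \rank (flat_mx u b j).
Proof.
move=> jb; apply: dim_row_space => d; rewrite flat_mxP //.
have [sC Cs] := linear_spanP (pattern_class (maxdot u) b).
split=> [|bd].
  pose U := lker (linfun (mulmx (edges u b j) : 'cV[R]_p -> 'cV[R]_k.+1)).
  have /subvP sub : (linear_span (pattern_class (maxdot u) b) <= U)%VS.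
    apply: Cs => c; rewrite pattern_class_maxdot => /flat_pattern bc.
    by rewrite memv_ker lfunE; apply/eqP/edges_flatP.
  by move/sub; rewrite memv_ker lfunE => /eqP/edges_flatP-/(_ jb).
have [e e0 eb] := flat_ray bd.
have -> : d = e^-1 *: ((b + e *: d) - b).
  by rewrite addrAC subrr add0r scalerA mulVf ?scale1r // gt_eqF.
by apply: memvZ; apply: memvB; apply: sC; rewrite pattern_class_maxdot.
Qed.

End Gauge.

(** * Existence of minimizers *)

Section LeastSquares.

Variable R : realType.

Lemma gram_eq0 m n (A : 'M[R]_(m, n)) : A^T *m A = 0 -> A = 0.
Proof.
move=> AA0; apply/matrixP => i j; rewrite mxE.
have /matrixP/(_ j j) := AA0; rewrite !mxE => /eqP.
rewrite psumr_eq0 => [/allP/(_ i (mem_index_enum i))|l _]; rewrite mxE.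
  by rewrite mulf_eq0 orbb => /eqP.
by rewrite -expr2 sqr_ge0.
Qed.

(** Critical points of [1/2 |X d|^2 - dotv g d] over the row space of [K] exist
    as soon as the linear term vanishes wherever the quadratic one does. With
    [G = K *m X^T] this is the solvability of a system with matrix [G *m G^T],
    whose kernel is that of [G^T]. *)
Lemma subspace_normal_equations m n p (K : 'M[R]_(m, p)) (X : 'M[R]_(n, p))
    (g : 'cV[R]_p) :
  (forall e : 'cV[R]_p, (e^T <= K)%MS -> X *m e = 0 -> dotv g e = 0) ->
  exists2 d : 'cV[R]_p, (d^T <= K)%MS &
    forall e : 'cV[R]_p, (e^T <= K)%MS -> dotv (X *m d) (X *m e) = dotv g e.
Proof.
move=> g0; pose G := K *m X^T.
have : ((K *m g)^T <= G *m G^T)%MS.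
  rewrite submxE; set C := cokermx _; apply/eqP/rowP => i.
  have GC : G^T *m C = 0.
    by apply: gram_eq0; rewrite trmx_mul trmxK mulmxA -(mulmxA _ G) -mulmxA
      mulmx_coker mulmx0.
  have := g0 (K^T *m col i C).
  rewrite trmx_mul trmxK submxMl mulmxA -[X]trmxK -trmx_mul -/G.
  rewrite colE [G^T *m _]mulmxA GC mul0mx => /(_ isT erefl).
  by rewrite /dotv !mulmxA -trmx_mul -colE mxE => ->; rewrite mxE.
case/submxP => a ga; exists (a *m K)^T; first by rewrite trmxK submxMl.
move=> e /submxP[c /(canRL trmxK) ->]; rewrite /dotv.
have XG q (v : 'M_(q, m)) : X *m (v *m K)^T = (v *m G)^T.
  by rewrite -[X]trmxK -trmx_mul mulmxA.
by rewrite !XG trmxK (trmx_mul c G) mulmxA -(mulmxA a) -ga !trmx_mul -!mulmxA.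
Qed.

End LeastSquares.

Section Crossing.

Variables (R : realType) (p k : nat) (u : 'I_k.+1 -> 'cV[R]_p).

(** The point where the first inactive index catches up with the active ones. *)
Lemma flat_crossing b d : flat u b d -> active u (b + d) != active u b ->
  exists2 t : R, 0 < t <= 1 & active u b \proper active u (b + t *: d).
Proof.
move=> bd neq; have [j jb] := active_ex u b.
pose J := [set i | (i \notin active u b) &&
                   (dotv (u j) (b + d) <= dotv (u i) (b + d))]%SET.
have [i1 J1] : exists i, i \in J.
  have : ~~ (active u (b + d) \subset active u b).
    by apply: contra neq => sub; rewrite flat_active_eq.
  case/fintype.subsetPn => i id ib; exists i.
  by rewrite finset.in_set ib active_le.
pose num i := dotv (u j) b - dotv (u i) b.
pose den i := dotv (u i) d - dotv (u j) d.
have num_gt0 i : i \notin active u b -> 0 < num i.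
  move=> ib; rewrite subr_gt0 lt_neqAle active_le // andbT.
  by apply: contra ib => /eqP ij; apply/activeP; rewrite ij; apply/activeP.
have den_gt i : i \in J -> 0 < num i <= den i.
  rewrite finset.in_set => /andP[ib].
  by rewrite num_gt0 //= /num /den !dotvDr; lra.
(* [num i / den i] is the time at which [i] catches up with [j]. *)
case: (arg_minP (fun i => num i / den i) J1) => i0 J0 i0_min.
have /andP[num0 le0] := den_gt _ J0; have den0 := lt_le_trans num0 le0.
set t := num i0 / den i0 in i0_min.
have t0 : 0 < t by rewrite divr_gt0.
have t1 : t <= 1 by rewrite ler_pdivrMr // mul1r.
have jt : j \in active u (b + t *: d).
  apply: le_active => i; rewrite !dotvDr !dotvZr.
  have [ib|ib] := boolP (i \in active u b).
    by rewrite (bd i j) // lerD2r active_le.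
  have [iJ|] := boolP (i \in J).
    have /andP[numi lei] := den_gt _ iJ; have deni := lt_le_trans numi lei.
    by have := i0_min _ iJ; rewrite ler_pdivlMr // /num /den; lra.
  rewrite finset.in_set ib /= -ltNge !dotvDr; have := num_gt0 _ ib.
  by rewrite /num => ? ?; nra.
have eq_active i : dotv (u i) (b + t *: d) = dotv (u j) (b + t *: d) ->
    i \in active u (b + t *: d).
  by move=> ij; apply/activeP; rewrite ij; apply/activeP.
exists t; first by rewrite t0.
apply/fintype.properP; split.
  apply/fintype.subsetP => i ib; apply: eq_active.
  rewrite !dotvDr !dotvZr (bd i j) //.
  by move/activeP: ib => ->; move/activeP: jb => ->.
exists i0; last by have : i0 \in J := J0; rewrite finset.in_set => /andP[].
apply: eq_active; rewrite !dotvDr !dotvZr.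
have : t * den i0 = num i0 by rewrite divfK // gt_eqF.
by rewrite /num /den; lra.
Qed.

End Crossing.

Section Existence.

Variables (R : realType) (n p k : nat) (X : 'M[R]_(n, p)) (lam : R).
Variables (u : 'I_k.+1 -> 'cV[R]_p) (y : 'cV[R]_n).
Hypotheses (u0 : u ord0 = 0) (lam_gt0 : 0 < lam).

Let f := objective X lam (maxdot u) y.
(** The opposite of the gradient at [b] of the quadratic obtained by replacing
    the gauge by its [j]-th linear form. *)
Let grad b j := X^T *m (y - X *m b) - lam *: u j.

Lemma objective_add b d : f (b + d) =
  f b - dotv (y - X *m b) (X *m d) + 2^-1 * dotv (X *m d) (X *m d)
  + lam * (maxdot u (b + d) - maxdot u b).
Proof.
rewrite /f /objective.
have := sqr_norm2BZ (y - X *m b) (X *m d) 1.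
rewrite scale1r -addrA -opprD -mulmxDr => ->.
by rewrite -(sqr_norm2 (X *m d)); lra.
Qed.

Lemma objective_add_active b d j :
    j \in active u b -> j \in active u (b + d) ->
  f (b + d) = f b - dotv (grad b j) d + 2^-1 * dotv (X *m d) (X *m d).
Proof.
move=> /activeP jb /activeP jd; rewrite objective_add -jd -jb dotv_mulmxr.
by rewrite dotvBl dotvZl dotvDr; ring.
Qed.

(** Criticality within the stratum of the points with the active set of [b]. *)
Definition stationary b := forall d j, flat u b d -> j \in active u b ->
  dotv (grad b j) d = 0.

(** On a stratum the objective is a convex quadratic, so a critical point is a
    minimum there; all critical points of a stratum share one value. *)
Lemma stationary_le b c : stationary b -> active u c = active u b -> f b <= f c.
Proof.
move=> b_stat cb; have [j jb] := active_ex u b.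
have bcb : b + (c - b) = c by rewrite addrC subrK.
have d_flat : flat u b (c - b).
  move=> i i' ib i'b; rewrite !dotvBr.
  by rewrite (flat_pattern cb ib i'b) (flat_pattern erefl ib i'b).
have := @objective_add_active b (c - b) j jb; rewrite bcb cb => /(_ jb) ->.
by rewrite b_stat // subr0 lerDl mulr_ge0 ?dotvv_ge0 ?invr_ge0.
Qed.

(** On the flat space of [b] the quadratic either has a critical point, or
    decreases affinely along some direction in the kernel of [X]. Moving
    accordingly, either the critical point is reached within the stratum or
    the active set grows on the way; in the second case it must grow, the gauge
    being nonnegative. *)
Lemma descent b : exists2 c, stationary c & f c <= f b.
Proof.
have [m] := ubnP (k.+1 - #|active u b|); elim: m b => // m IH b lt_m.
have [j jb] := active_ex u b.
have cross d : flat u b d -> active u (b + d) != active u b ->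
    (forall t : R, 0 < t <= 1 -> j \in active u (b + t *: d) ->
      f (b + t *: d) <= f b) ->
    exists2 c, stationary c & f c <= f b.
  move=> bd neq dec; have [t t01 lt_b] := flat_crossing bd neq.
  have [|c c_stat le_c] := IH (b + t *: d).
    have lt_card := proper_card lt_b; rewrite ltnS in lt_m.
    apply: leq_trans (_ : _ < _)%N lt_m.
    apply: ltn_sub2l (lt_card); apply: leq_trans lt_card _.
    by rewrite -[X in (_ <= X)%N]card_ord max_card.
  exists c => //; apply: le_trans le_c (dec _ t01 _).
  by case/fintype.properP: lt_b => /fintype.subsetP/(_ _ jb).
have [g0|/existsNP[e]] := pselect (forall e : 'cV[R]_p,
    (e^T <= flat_mx u b j)%MS -> X *m e = 0 -> dotv (grad b j) e = 0);
  last first.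
  move=> /not_implyP[/flat_mxP-/(_ jb) be /not_implyP[Xe /eqP ge]].
  wlog ge0 : e be Xe ge / 0 < dotv (grad b j) e.
    move=> wl; have [|lt0|//] := ltgtP 0 (dotv (grad b j) e); first exact: wl.
      by apply: (wl (- e)); rewrite ?mulmxN ?Xe ?oppr0 // ?dotvNr ?oppr_gt0
        ?oppr_eq0 //; apply: flatN.
    by move=> g0; rewrite -g0 eqxx in ge.
  have gE t : dotv (grad b j) (t *: e) = - (lam * t * dotv (u j) e).
    by rewrite dotvBl -dotv_mulmxr -scalemxAr Xe scaler0 dotv0 sub0r dotvZl
      dotvZr mulrA.
  have uj0 : dotv (u j) e < 0.
    by move: ge0; rewrite -[e in dotv _ e]scale1r gE mulr1 oppr_gt0 pmulr_rlt0.
  (* At time [T] the [j]-th form is [-1], below the nonnegative gauge. *)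
  pose T := (maxdot u b + 1) / - dotv (u j) e.
  have T0 : 0 < T by rewrite divr_gt0 ?oppr_gt0 // ltr_wpDl ?maxdot_ge0.
  apply: (cross (T *: e)); first exact: flatZ.
    apply/eqP => eqb; have jT : j \in active u (b + T *: e) by rewrite eqb.
    have := maxdot_ge0 (b + T *: e) u0; move/activeP: jT => <-.
    rewrite dotvDr dotvZr /T mulrAC invrN mulrN mulfK ?lt_eqF //.
    by move/activeP: jb => ->; lra.
  move=> t /andP[t0 t1] jt; rewrite (objective_add_active jb) //.
  rewrite scalerA gE -scalemxAr Xe scaler0 dotv0 mulr0 addr0 opprK gerDl.
  by rewrite pmulr_rle0 ?ltW // mulr_gt0 // mulr_gt0.
have [d /flat_mxP-/(_ jb) bd dP] := subspace_normal_equations g0.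
have XdXd : dotv (X *m d) (X *m d) = dotv (grad b j) d.
  by apply: dP; apply/flat_mxP.
have line t : 0 <= t <= 1 -> j \in active u (b + t *: d) ->
    f (b + t *: d) <= f b.
  move=> /andP[t0 t1] jt; rewrite (objective_add_active jb) //.
  rewrite -scalemxAr !dotvZr dotvZl XdXd -XdXd.
  have := dotvv_ge0 (X *m d); set Q := dotv _ _ => Q0.
  rewrite -addrA gerDl.
  have : t * Q * (2^-1 * t - 1) <= 0 by rewrite mulr_ge0_le0 ?mulr_ge0 //; lra.
  by lra.
have [eqb|neq] := eqVneq (active u (b + d)) (active u b); last first.
  by apply: (cross d) => // t /andP[t0 t1]; apply: line; rewrite ltW.
exists (b + d).
  move=> e i; rewrite eqb => be' ib.
  have be : flat u b e by move=> l l' lb l'b; apply: be'; rewrite eqb.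
  have -> : dotv (grad (b + d) i) e =
      dotv (grad b i) e - dotv (X *m d) (X *m e).
    by rewrite !dotvBl -!dotv_mulmxr mulmxDr opprD addrA dotvBl; ring.
  rewrite dP; last exact/flat_mxP.
  by rewrite !dotvBl !dotvZl (be i j) // subrr.
by have := line 1; rewrite scale1r lexx ler01 eqb; apply.
Qed.

(** Among the finitely many critical values, one per stratum, the least is the
    global minimum because of [descent]. *)
Lemma minimizer_exists : exists b, minimizers X lam (maxdot u) y b.
Proof.
pose S I := [set b | stationary b /\ active u b = I].
pose good I := `[< exists b, S I b >].
have good_active b : stationary b -> good (active u b).
  by move=> b_stat; apply/asboolP; exists b.
have [b0 b0_stat _] := descent 0.
case: (arg_minP (fun I => f (xget 0 (S I))) (good_active _ b0_stat)).
move=> I /asboolP SI I_min; exists (xget 0 (S I)) => b'.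
have [c c_stat c_le] := descent b'; apply: le_trans c_le.
have cI := good_active _ c_stat.
apply: le_trans (I_min _ cI) _.
have [d_stat dc] := xgetPex 0 (asboolW cI).
exact: stationary_le.
Qed.

End Existence.

(** * Uniqueness and accessible patterns *)

Lemma minimizers_subdifferential (R : realType) (n p : nat) (X : 'M[R]_(n, p))
    (pen : 'cV[R]_p -> R) lam y b :
  polyhedral_gauge pen -> 0 < lam ->
  minimizers X lam pen y b <->
  subdifferential pen b (lam^-1 *: (X^T *m (y - X *m b))).
Proof.
move=> gpen lam_gt0; rewrite (minimizersP _ _ _ gpen lam_gt0).
have scale d r : (dotv (y - X *m b) (X *m d) <= lam * r) =
    (dotv (lam^-1 *: (X^T *m (y - X *m b))) d <= r).
  by rewrite dotvZl -dotv_mulmxr ler_pdivrMl.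
split=> bmin d; last first.
  rewrite scale; have := bmin (b + d).
  by rewrite [b + d - b]addrAC subrr add0r; lra.
have := bmin (d - b); rewrite scale [b + (d - b)]addrC subrK; lra.
Qed.

Section Uniqueness.

Variables (R : realType) (n p k : nat) (X : 'M[R]_(n, p)).
Variable u : 'I_k.+1 -> 'cV[R]_p.
Hypothesis u0 : u ord0 = 0.

Let pen_gauge := polyhedral_gauge_maxdot u0.

(** Two minimizers have the same fit and the same gauge. At their midpoint an
    active form attains the mean of the two values of the gauge, so it is
    tight at both of them. *)
Lemma minimizers_mid lam y b c : 0 < lam ->
    minimizers X lam (maxdot u) y b -> minimizers X lam (maxdot u) y c ->
  let m := b + 2^-1 *: (c - b) in
  [/\ minimizers X lam (maxdot u) y m, X *m (c - b) = 0 & flat u m (c - b)].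
Proof.
move=> lam_gt0 bmin cmin m.
have bP := (minimizersP _ _ _ pen_gauge lam_gt0).1 bmin.
have cP := (minimizersP _ _ _ pen_gauge lam_gt0).1 cmin.
have := bP (c - b); have := cP (b - c).
rewrite [b + (c - b)]addrC [c + (b - c)]addrC !subrK => hc hb.
have Xd : X *m (c - b) = 0.
  apply/eqP; rewrite -dotvv_eq0 eq_le dotvv_ge0 andbT.
  move: hc; rewrite -[b - c]opprB mulmxN dotvNr.
  have -> : y - X *m c = y - X *m b - X *m (c - b).
    by rewrite mulmxBr opprB addrA subrK.
  by rewrite dotvBl; lra.
have Xd' : X *m (b - c) = 0 by rewrite -opprB mulmxN Xd oppr0.
have pen_bc : maxdot u c = maxdot u b.
  move: hb hc; rewrite Xd Xd' !dotv0 !pmulr_rge0 // !subr_ge0 => ? ?.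
  by apply/eqP; rewrite eq_le; apply/andP.
have pen_m : maxdot u m = maxdot u b.
  apply/eqP; rewrite eq_le; apply/andP; split.
    have := @gauge_convex _ _ _ b (c - b) 2^-1 pen_gauge.
    by rewrite [b + (c - b)]addrC subrK pen_bc subrr mulr0 addr0; apply; lra.
  have := bP (2^-1 *: (c - b)).
  by rewrite -scalemxAr Xd scaler0 dotv0 pmulr_rge0 // subr_ge0.
split=> //.
  move=> b'; apply: le_trans (bmin b').
  by rewrite /objective /m mulmxDr -scalemxAr Xd scaler0 addr0 -/m pen_m.
have key i : i \in active u m -> dotv (u i) (c - b) = 0.
  move/activeP; rewrite pen_m /m dotvDr dotvZr dotvBr => im.
  have := dotv_le_maxdot u i b; have := dotv_le_maxdot u i c.
  by rewrite pen_bc; lra.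
by move=> i j im jm; rewrite !key.
Qed.

(** The subdifferential at [b] is the face [F = conv {u i | i active at b}], and
    [w] is parallel to it. Let [phi h] be the maximum of [0] and the
    [dotv (u i - s) h], [i] active: it is the support function of [F - s]. A
    minimizer [h] of [1/2 (1 - dotv w h)^2 + mu * phi h] provides a multiple
    [r *: w] in the subdifferential of [phi] at [h]; then [s + r *: w] lies on
    the face of [F] exposed by [h], which is the subdifferential at
    [b + e *: h] for small [e]. This face is proper unless [h] is flat; then
    [dotv w h = 0], which the choice of [mu] excludes. *)
Lemma face_shrink b s z : s = X^T *m z ->
  subdifferential (maxdot u) b s ->
  forall w, w != 0 -> (exists x, w = X^T *m x) ->
  (forall d, flat u b d -> dotv w d = 0) ->
  exists b' z', [/\ active u b' \proper active u b &
    subdifferential (maxdot u) b' (X^T *m z')].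
Proof.
move=> sz /subdifferential_maxdotP[s_le s_ge] w w0 [x wx] w_flat.
(* The generators of [F - s], padded with zeros, the first one included. *)
pose v (i : 'I_k.+2) : 'cV[R]_p :=
  if unlift ord0 i is Some j then
    if j \in active u b then u j - s else 0
  else 0.
have v0 : v ord0 = 0 by rewrite /v unlift_none.
have vS i : i \in active u b -> v (lift ord0 i) = u i - s.
  by rewrite /v liftK => ->.
have phi_ge i h : i \in active u b -> dotv (u i) h - dotv s h <= maxdot v h.
  by move=> ib; rewrite -dotvBl -vS // dotv_le_maxdot.
have phi_le h (m : R) : 0 <= m ->
    (forall i, i \in active u b -> dotv (u i) h - dotv s h <= m) ->
    maxdot v h <= m.
  move=> m0 mP; apply: maxdot_le => i; rewrite /v.
  case: unliftP => [j _|_]; last by rewrite dot0v.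
  by case: ifP => [jb|_]; rewrite ?dot0v // dotvBl mP.
have sb : dotv s b = maxdot u b by apply/eqP; rewrite eq_le s_le.
have ww : 0 < dotv w w by rewrite dotvv_gt0.
(* Small enough that [mu^-1 *: w] lies outside [F - s], as [F] is bounded. *)
pose mu := dotv w w / (maxdot v w + 1).
have phiw := maxdot_ge0 w v0.
have mu_gt0 : 0 < mu by rewrite divr_gt0 // ltr_wpDl.
have [h hmin] := minimizer_exists w^T (const_mx 1 : 'cV[R]_1) v0 mu_gt0.
have v_gauge := polyhedral_gauge_maxdot v0.
have := (minimizers_subdifferential _ _ _ v_gauge mu_gt0).1 hmin.
move/subdifferential_maxdotP; pose r := mu^-1 * (1 - dotv w h).
have -> : mu^-1 *: (w^T^T *m (const_mx 1 - w^T *m h)) = r *: w.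
  rewrite trmxK [X in w *m X]mx11_scalar mul_mx_scalar scalerA /r.
  by rewrite /dotv !mxE.
case=> r_le r_ge; have wh : dotv w h != 0.
  apply/eqP => wh0; have := r_le w.
  rewrite dotvZl /r wh0 subr0 mulr1 /mu invf_div divfK ?gt_eqF //; lra.
(* All of [F] takes the same value at [b], so [phi] is zero at [b] and [- b]. *)
have rwb : r * dotv w b = 0.
  have phi_b t : maxdot v (t *: b) <= 0.
    apply: phi_le => // i /activeP ib; rewrite !dotvZr ib sb subrr //.
  have := r_le (1 *: b); have := r_le (-1 *: b).
  have := phi_b 1; have := phi_b (-1); rewrite !dotvZl !dotvZr; lra.
have [e e0 eb] := active_ray u b h.
have zE : X^T *m (z + r *: x) = s + r *: w by rewrite sz wx mulmxDr scalemxAr.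
exists (b + e *: h), (z + r *: x); rewrite zE; split.
  rewrite finset.properEneq eb andbT; apply: contra wh => /eqP eqb.
  apply/eqP/w_flat => i j ib jb.
  have := flat_pattern eqb ib jb; rewrite !dotvDr !dotvZr.
  move/activeP: ib => ->; move/activeP: jb => -> /addrI.
  by apply: mulfI; rewrite gt_eqF.
apply/subdifferential_maxdotP; split=> [c|].
  rewrite dotvDl -lerBrDl; apply: le_trans (r_le c) _.
  by apply: phi_le => [|i _]; rewrite ?subr_ge0 // lerD2r dotv_le_maxdot.
have [j jb'] := active_ex u (b + e *: h); have jb := fintype.subsetP eb _ jb'.
move/activeP: jb' => <-; have /activeP uj := jb; have := phi_ge _ h jb.
move: r_ge; rewrite !dotvDl !dotvDr !dotvZl !dotvZr rwb uj sb => h1 h2.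
have : e * dotv (u j) h <= e * (dotv s h + r * dotv w h).
  by rewrite ler_pM2l //; lra.
by lra.
Qed.

Lemma rank_lt_ex m (A : 'M[R]_(m, n)) : (\rank A < \rank X)%N ->
  exists2 q : 'cV[R]_p, A *m (X *m q) = 0 & X *m q != 0.
Proof.
move=> AX; have /row_subPn[i] : ~~ (kermx (A *m X)^T <= kermx X^T)%MS.
  apply: contraL AX => /mxrankS.
  rewrite !mxrank_ker !mxrank_tr -leqNgt => le_ker.
  apply: leq_trans (mxrankM_maxl A X); rewrite -(leq_sub2lE _ (rank_leq_col X)).
  exact: le_ker.
set q := row i _ => qX; exists q^T.
  apply: trmx_inj; rewrite mulmxA trmx_mul trmxK trmx0.
  by apply/sub_kermxP; apply: row_sub.
apply: contra qX => /eqP Xq; apply/sub_kermxP.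
by apply: trmx_inj; rewrite trmx_mul trmxK Xq trmx0.
Qed.

(** Induction on the number of active indices. If the flat space [V_b] has
    dimension at most the rank of [X], then, as [d] is in [V_b] and in the
    kernel of [X], the image of [V_b] under [X] is smaller than the range of
    [X]; some nonzero [X *m q] in the range is orthogonal to it, and
    [w = X^T *m (X *m q)] is a direction for [face_shrink]. The direction [d]
    remains flat when the active set shrinks. *)
Lemma accessible_complex lam b z d : 0 < lam ->
    subdifferential (maxdot u) b (X^T *m z) ->
    flat u b d -> X *m d = 0 -> d != 0 ->
  exists2 b', accessible X lam (maxdot u) b' &
    (\rank X < complexity (maxdot u) b')%N.
Proof.
move=> lam_gt0 + + Xd d0.
have [m] := ubnP #|active u b|; elim: m b z => // m IH b z lt_m bz bd.
have [j jb] := active_ex u b.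
have [lt_c|le_c] := ltnP (\rank X) (complexity (maxdot u) b).
  exists b => //; exists (X *m b + lam *: z), b; split=> //.
  apply/minimizers_subdifferential => //.
  rewrite [X *m b + _]addrC addrK -scalemxAr scalerA.
  by rewrite mulVf ?gt_eqF // scale1r.
have [|q Aq Xq] := @rank_lt_ex _ (flat_mx u b j *m X^T).
  apply: leq_trans le_c; rewrite (complexity_maxdot jb).
  rewrite -(mxrank_mul_ker (flat_mx u b j) X^T) -addn1 leq_add2l.
  rewrite lt0n mxrank_eq0.
  apply/rowV0Pn; exists d^T; last by rewrite -trmx0 (inj_eq trmx_inj).
  rewrite sub_capmx; apply/andP; split; first exact/flat_mxP.
  by apply/sub_kermxP; rewrite -trmx_mul Xd trmx0.
have [||e be|b' [z' [lt_b bz']]] :=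
  @face_shrink b _ z erefl bz (X^T *m (X *m q)).
- apply: contra Xq => /eqP w0.
  by rewrite -dotvv_eq0 dotv_mulmxr w0 dot0v.
- by exists (X *m q).
- rewrite -dotv_mulmxr dotvC /dotv trmx_mul.
  have /submxP[c ->] : (e^T <= flat_mx u b j)%MS by apply/flat_mxP.
  by rewrite -mulmxA -mulmxA [_ *m (X^T *m _)]mulmxA Aq mulmx0 mxE.
apply: IH bz' _; first by apply: leq_trans (proper_card lt_b) _.
have /fintype.subsetP sub := fintype.proper_sub lt_b.
by move=> i i' ib ib'; apply: bd; apply: sub.
Qed.

Lemma unique_not_accessible lam beta : 0 < lam ->
    (forall y, exists! b, minimizers X lam (maxdot u) y b) ->
    (\rank X < complexity (maxdot u) beta)%N ->
  ~ accessible X lam (maxdot u) beta.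
Proof.
move=> lam_gt0 uniq lt_c [y [b [bmin bbeta]]].
have {lt_c} : (\rank X < complexity (maxdot u) b)%N.
  by rewrite /complexity /pattern_class bbeta.
have [j jb] := active_ex u b; rewrite (complexity_maxdot jb) => lt_c.
have : \rank (flat_mx u b j :&: kermx X^T)%MS != 0%N.
  apply: contraTN lt_c => /eqP rk0; rewrite -leqNgt.
  rewrite -(mxrank_mul_ker (flat_mx u b j) X^T) rk0 addn0 -(mxrank_tr X).
  exact: mxrankM_maxr.
rewrite mxrank_eq0 => /rowV0Pn[d'].
rewrite -[d']trmxK sub_capmx -trmx0 (inj_eq trmx_inj); move: d'^T => d.
case/andP=> /(flat_mxP _ jb) bd /sub_kermxP Xd d0.
have {}Xd : X *m d = 0 by apply: trmx_inj; rewrite trmx_mul Xd trmx0.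
have key c : flat u b c -> X *m c = 0 -> 0 <= dotv (u j) c /\
    exists2 e, 0 < e & maxdot u (b + e *: c) = maxdot u b + e * dotv (u j) c.
  move=> bc Xc; have [e e0 eb] := flat_ray bc.
  have penE : maxdot u (b + e *: c) = maxdot u b + e * dotv (u j) c.
    have /activeP <- : j \in active u (b + e *: c) by rewrite eb.
    by rewrite dotvDr dotvZr; move/activeP: jb => ->.
  split; last by exists e.
  have := (minimizersP _ _ _ pen_gauge lam_gt0).1 bmin (e *: c).
  rewrite -scalemxAr Xc scaler0 dotv0 penE [_ + _ - _]addrAC subrr add0r.
  by rewrite !pmulr_rge0.
have [ge0 [e e0 penE]] := key d bd Xd.
have [|le0 _] := key (- d) (flatN bd); first by rewrite mulmxN Xd oppr0.
have uj0 : dotv (u j) d = 0 by move: le0; rewrite dotvNr; lra.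
have bmin' : minimizers X lam (maxdot u) y (b + e *: d).
  move=> c; apply: le_trans (bmin c).
  rewrite /objective mulmxDr -scalemxAr Xd scaler0 addr0.
  by rewrite penE uj0 mulr0 addr0.
have [b0 [_ b0_uniq]] := uniq y.
have : b = b + e *: d by rewrite -(b0_uniq _ bmin'); apply/esym/b0_uniq.
rewrite -{1}[b]addr0 => /addrI/esym/eqP.
by rewrite scaler_eq0 (negPf d0) gt_eqF.
Qed.

Lemma not_accessible_unique lam y : 0 < lam ->
    (forall beta, (\rank X < complexity (maxdot u) beta)%N ->
      ~ accessible X lam (maxdot u) beta) ->
  exists! b, minimizers X lam (maxdot u) y b.
Proof.
move=> lam_gt0 no_acc; have [b bmin] := minimizer_exists X y u0 lam_gt0.
exists b; split=> // c cmin; apply/eqP/negPn/negP => bc.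
have [mmin Xd md] := minimizers_mid lam_gt0 bmin cmin.
move: mmin; rewrite minimizers_subdifferential // scalemxAr => mmin.
have [|b' acc lt_c] := accessible_complex lam_gt0 mmin md Xd.
  by rewrite subr_eq0 eq_sym.
exact: no_acc acc.
Qed.

End Uniqueness.

Unset Implicit Arguments.

Theorem corollary6p2 (R : realType) (n p : nat) (X : 'M[R]_(n, p))
    (pen : 'cV[R]_p -> R) (lam : R)
    (pen_gauge : polyhedral_gauge pen) (lam_gt0 : 0 < lam) :
  (forall y : 'cV[R]_n, exists! b : 'cV[R]_p, minimizers X lam pen y b) <->
  (forall beta : 'cV[R]_p,
     (\rank X < complexity pen beta)%N -> ~ accessible X lam pen beta).
Proof.
have [k [u [u0 penE]]] := pen_gauge.
have {penE} -> : pen = maxdot u by apply/funext => b; rewrite penE.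
split=> [uniq beta|no_acc y]; first exact: unique_not_accessible.
exact: not_accessible_unique.
Qed.
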